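(* Let $3\leq k\leq 5$ and $\mathbf{x}=(x_1,\ldots,x_n)\in\Delta^{n-1}$, and let $\sigma=\sigma(\mathbf{x})$. If $x_n\leq\cdots\leq x_1\leq 1/k$, then \[ \frac{\partial S_k(\mathbf{x})}{\partial x_1}<k\sigma^k\binom{1/\sigma}{k}, \] unless the nonzero entries of $\mathbf{x}$ are equal.
   Context: $\Delta^{n-1}=\{\mathbf{x}\in\mathbb{R}^n: x_i\geq0 \text{ for all } i,\ \sum_i x_i=1\}$. $S_k(\mathbf{x})$ denotes the $k$-th elementary symmetric polynomial in the variables $x_1,\ldots,x_n$, and $\partial S_k/\partial x_1$ is its partial derivative, i.e. the $(k-1)$-th elementary symmetric polynomial of $x_2,\ldots,x_n$. $\sigma(\mathbf{x})=x_1^{x_1}\cdots x_n^{x_n}$, with the convention $0^0=1$. For real $s$, $\binom{s}{k}=s(s-1)\cdots(s-k+1)/k!$. *)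

(* Defs.v *)
From HB Require Import structures.
From mathcomp Require Import all_boot all_order all_algebra.
From mathcomp Require Import reals exp.
Set Implicit Arguments. Unset Strict Implicit. Unset Printing Implicit Defensive.
Import Order.TTheory GRing.Theory Num.Theory.
Local Open Scope ring_scope.

Section Defs.
Variable R : realType.

Definition in_simplex (n : nat) (x : 'I_n -> R) : Prop :=
  (forall i, 0 <= x i) /\ \sum_(i < n) x i = 1.

Definition esymA (n : nat) (j : nat) (A : {set 'I_n}) (x : 'I_n -> R) : R :=
  \sum_(B : {set 'I_n} | (B \subset A) && (#|B| == j)) \prod_(i in B) x i.

Definition dSk_dx1 (n : nat) (k : nat) (x : 'I_n.+1 -> R) : R :=
  esymA k.-1 [set i : 'I_n.+1 | i != ord0] x.

(* sigma(x) = prod x_i^{x_i}, with 0^0 = 1 (powR 0 0 = 1) *)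
Definition sigma (n : nat) (x : 'I_n -> R) : R := \prod_(i < n) powR (x i) (x i).

Definition binomR (s : R) (k : nat) : R :=
  (\prod_(i < k) (s - i%:R)) / (k`!)%:R.
End Defs.

(* Main.v *)
(* Put a = x_1, u_i = x_i / a in [0, 1], and let E be the expectation under the weights x_i;
   write s = E(1 - u), v = E(1 - u)^2 and V = v - s^2 for the variance of u. Since
   ln u + u^2/2 is concave on (0, 1], Jensen gives sigma <= a (1 - s) exp(- V/2), hence
   d = 1 - sigma/a satisfies d >= s + (1 - s) V / (2 + s).
   Times (k-1)!, the two sides are h(sigma) = prod_(1 <= i < k) (1 - i sigma) and, by
   Newton's identities, h(a) + a (c s + e v + f s^2) at most, with c, e, f polynomials
   in a (for k = 5 this uses E u (1 - u)^2 >= 0 to bound the fourth power sum from below).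
   On the other side h(a (1 - d)) - h(a) >= a (A d + B d^2). With the bound on d, the
   comparison is affine in V, so only V = 0 and V = s (1 - s) matter; there it reduces to
   polynomial inequalities in a <= 1/k and s, which are strict when s > 0, that is, when
   the nonzero entries are not all equal. *)

Require Import Defs.
From HB Require Import structures.
From mathcomp Require Import all_boot all_order all_algebra.
From mathcomp Require Import reals exp.
From mathcomp Require Import sequences normedtype derive lra ring.
Import Order.TTheory GRing.Theory Num.Theory.
Import numFieldNormedType.Exports.
Local Open Scope ring_scope.

(** * Elementary symmetric sums over a subset, and Newton's identities *)

Lemma esymA0 (R : realType) n (A : {set 'I_n}) (x : 'I_n -> R) : esymA 0 A x = 1.
Proof.
rewrite /esymA (big_pred1 set0) ?big_set0// => B /=.
by rewrite cards_eq0; case: (B =P set0) => [->|]; rewrite ?sub0set ?andbF.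
Qed.

Lemma esymA_set0 (R : realType) n j (x : 'I_n -> R) : esymA j.+1 set0 x = 0.
Proof.
rewrite /esymA big_pred0// => B; rewrite subset0.
by case: eqP => [->|//]; rewrite cards0.
Qed.

Lemma esymA_setU1 (R : realType) n j i (A : {set 'I_n}) (x : 'I_n -> R) :
  i \notin A -> esymA j.+1 (i |: A) x = esymA j.+1 A x + x i * esymA j A x.
Proof.
move=> iA; rewrite /esymA (bigID (fun B : {set 'I_n} => i \in B)) [LHS]addrC/=; congr (_ + _).
  apply: eq_bigl => B; rewrite andbAC; congr (_ && _).
  have -> : A = (i |: A) :\ i by rewrite setU1K.
  by rewrite subsetD1 setD1K ?setU11.
rewrite mulr_sumr (reindex_onto (fun B => i |: B) (fun B => B :\ i))/=; last first.
  by move=> B /andP[_ iB]; rewrite setD1K.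
apply: eq_big => [B|B].
  rewrite setU11 andbT; case: (boolP (i \in B)) => iB.
    have -> : ((i |: B) :\ i == B) = false.
      by apply/eqP => /setP/(_ i); rewrite !inE eqxx iB.
    rewrite andbF; apply/esym/negbTE; rewrite negb_and; apply/orP; left.
    by apply: contra iA => /subsetP/(_ _ iB).
  rewrite setU1K// eqxx andbT cardsU1 iB add1n eqSS; congr (_ && _).
  by rewrite -{2}(setU1K iA) subsetD1 iB andbT subUset sub1set setU11.
move=> /andP[_ /eqP BE]; rewrite big_setU1// -BE.
by rewrite !inE eqxx.
Qed.

(** Induction on the size of [A], adding one element by [esymA_setU1]; the factorials keep the
    identities free of division. *)
Lemma esymA_newton (R : realType) n (A : {set 'I_n}) (x : 'I_n -> R) :
  let q j := \sum_(i in A) x i ^+ j in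
  [/\ esymA 1 A x = q 1%N,
      2 * esymA 2 A x = q 1%N ^+ 2 - q 2%N,
      6 * esymA 3 A x = q 1%N ^+ 3 - 3 * q 1%N * q 2%N + 2 * q 3%N &
      24 * esymA 4 A x = q 1%N ^+ 4 - 6 * q 1%N ^+ 2 * q 2%N + 8 * q 1%N * q 3%N
                         + 3 * q 2%N ^+ 2 - 6 * q 4%N].
Proof.
have [m] := ubnP #|A|; elim: m A => // m IH A.
have [->|[i iA]] := set_0Vmem A.
  by rewrite /= !esymA_set0 !big_set0; split; ring.
rewrite -(setD1K iA) cardsU1 !inE eqxx add1n ltnS => /IH[].
have iN : i \notin A :\ i by rewrite !inE eqxx.
rewrite /= !(esymA_setU1 _ _ _ _ _ _ iN) !big_setU1//= esymA0.
move=> e1 e2 e3 e4; split; first by rewrite e1; ring.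
- by rewrite mulrDr e2 e1; ring.
- have -> (e f : R) : 6 * (e + x i * f) = 6 * e + 3 * x i * (2 * f) by ring.
  by rewrite e3 e2; ring.
- have -> (e f : R) : 24 * (e + x i * f) = 24 * e + 4 * x i * (6 * f) by ring.
  by rewrite e4 e3; ring.
Qed.

(** * Bounding [sigma] by moments *)

(** This is the tangent line at [m] of the concave function ln u + u^2/2, with the quadratic terms
    moved to the right. *)
Lemma ln_le_quad (R : realType) (u m : R) : 0 < u <= 1 -> 0 < m <= 1 ->
  ln u <= ln m + (u - m) / m - (u - m) ^+ 2 / 2.
Proof.
move=> /andP[u0 u1] /andP[m0 m1].
pose g (y : R) := ln y - ln m - (y - m) / m + (y - m) ^+ 2 / 2.
pose dg (y : R) := y^-1 - m^-1 + (y - m).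
have dgE y : 0 < y -> dg y = (m - y) * ((1 - y * m) / (y * m)).
  by move=> y0; rewrite /dg; field; rewrite !gt_eqF.
have Dg (y : R) : 0 < y -> is_derive y 1 g (dg y).
  move=> y0; have H := @is_derive1_ln R y y0.
  rewrite /g; apply: is_derive_eq.
  by rewrite /dg /GRing.scale/=; field; rewrite !gt_eqF.
have Cg b c (y : R) : 0 < b -> y \in `[b, c] -> derivable g y 1.
  by move=> b0; rewrite in_itv/= => /andP[/(lt_le_trans b0)/Dg[]].
(* [g m] is 0, and [dg y] is [m - y] times a factor that is nonnegative since [y * m <= 1], so [g]
   is largest at [m]. *)
suff : g u <= g m by rewrite /g; lra.
have K y : 0 < y -> y <= 1 -> 0 <= (1 - y * m) / (y * m).
  move=> y0 y1; apply: divr_ge0; last by rewrite mulr_ge0// ltW.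
  by rewrite subr_ge0 mulr_ile1// ltW.
have [um|mu] := leP u m.
  have [||c] := @MVT_segment R g dg u m um.
  - by move=> y; rewrite in_itv/= => /andP[uy _]; apply: Dg; apply: lt_trans uy.
  - by apply: derivable_within_continuous => y; apply: Cg => //.
  rewrite in_itv/= => /andP[uc cm] E.
  rewrite -subr_ge0 E mulr_ge0 ?subr_ge0// dgE; last exact: lt_le_trans uc.
  rewrite mulr_ge0 ?subr_ge0// K//; first exact: lt_le_trans uc.
  exact: le_trans m1.
have [||c] := @MVT_segment R g dg m u (ltW mu).
- by move=> y; rewrite in_itv/= => /andP[uy _]; apply: Dg; apply: lt_trans uy.
- by apply: derivable_within_continuous => y; apply: Cg => //.
rewrite in_itv/= => /andP[mc cu] E.
rewrite -subr_le0 E mulr_le0_ge0 ?subr_ge0 ?(ltW mu)// dgE; last exact: lt_le_trans mc.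
rewrite mulr_le0_ge0 ?subr_le0// K//; first exact: lt_le_trans mc.
exact: le_trans u1.
Qed.

Lemma sigma_gt0 (R : realType) n (x : 'I_n -> R) : in_simplex x -> 0 < sigma x.
Proof.
case=> x0 _; apply: prodr_gt0 => i _.
have := x0 i; rewrite le_eqVlt => /orP[/eqP<-|]; last exact: powR_gt0.
by rewrite powRr0.
Qed.

(** Under the weights [x i], the ratios [x i / a] have mean [m] and variance [V]. Averaging
    [ln_le_quad] bounds ln sigma by ln (a m) - V/2, and exp (V/2) >= 1 + V/2. *)
Lemma sigma_le_moments (R : realType) n (x : 'I_n -> R) (a m V : R) :
  in_simplex x -> 0 < a -> (forall i, x i <= a) -> 0 < m <= 1 ->
  \sum_i x i ^+ 2 = a * m -> \sum_i x i ^+ 3 = a ^+ 2 * (m ^+ 2 + V) -> 0 <= V ->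
  sigma x <= a * m / (1 + V / 2).
Proof.
move=> [x0 x1] a0 xa m01 p2 p3 V0; have /andP[m0 m1] := m01.
have sE : sigma x = expR (\sum_i x i * ln (x i)).
  rewrite expR_sum /sigma; apply: eq_bigr => i _; rewrite /powR.
  by case: eqP => [->|//]; rewrite mul0r expR0.
have step i : x i * ln (x i) <= (ln a + ln m - 1 - m ^+ 2 / 2) * x i
    + ((a * m)^-1 + m / a) * x i ^+ 2 - (2 * a ^+ 2)^-1 * x i ^+ 3.
  (* A zero entry gives 0 on both sides, whatever the value of [ln 0]. *)
  have := x0 i; rewrite le_eqVlt => /orP[/eqP<-|xi0].
    by rewrite mul0r !expr0n /=; lra.
  have u01 : 0 < x i / a <= 1 by rewrite divr_gt0// ler_pdivrMr// mul1r xa.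
  have := ln_le_quad _ _ _ u01 m01; rewrite ln_div ?posrE// => H.
  have {}H : ln (x i) <= ln a + (ln m + (x i / a - m) / m - (x i / a - m) ^+ 2 / 2) by lra.
  have := ler_wpM2l (ltW xi0) H; congr (_ <= _).
  by field; rewrite !gt_eqF.
have : \sum_i x i * ln (x i) <= ln (a * m) - V / 2.
  apply: (le_trans (ler_sum _ (fun i _ => step i))).
  rewrite !big_split/= sumrN -!mulr_sumr x1 p2 p3 lnM ?posrE// le_eqVlt.
  by apply/orP; left; apply/eqP; field; rewrite !gt_eqF.
rewrite -[in X in X -> _]ler_expR -sE => /le_trans; apply.
rewrite expRB lnK ?posrE ?mulr_gt0//.
rewrite ler_pM2l ?mulr_gt0// lef_pV2 ?posrE ?expR_gt0 ?expR_ge1Dx//.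
by lra.
Qed.

(** * Polynomial inequalities in [a] and [s] *)

(** The last hypothesis of [quadratic_gap] for the coefficients of [gap4]. *)
Lemma quartic_edge_gt0 (R : realType) (a s : R) : a <= 4^-1 -> 0 <= s <= 1 ->
  0 < (2 + s) * (3 - 17 * a + 18 * a ^+ 2 + s * (11 * a - 18 * a ^+ 2))
      + (6 - 22 * a + 18 * a ^+ 2 + 2 * (11 * a - 18 * a ^+ 2) * s) * (1 - s) ^+ 2.
Proof.
move=> a1 /andP[s0 s1].
have [b [b0 ->]] : exists b, 0 <= b /\ a = (1 - b) / 4.
  by exists (1 - 4 * a); split; [lra | field].
(* Expand in powers of b, with coefficients f0, f1, f2 in s. *)
have f0 : 0 < 11 + 25 * s - 26 * s ^+ 2 + 26 * s ^+ 3.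
  by have := mulr_ge0 s0 (sqr_ge0 (2 * s - 1)); clear -s0; lra.
have f1 : 0 <= 29 - 26 * s + 19 * s ^+ 2 - 4 * s ^+ 3.
  have : s ^+ 3 <= 1 by rewrite exprn_ile1.
  by have := sqr_ge0 (s - 1); clear -s0; lra.
have f2 : 0 <= (1 - s) * (27 - 18 * s + 18 * s ^+ 2).
  by rewrite mulr_ge0 ?subr_ge0//; have := sqr_ge0 s; clear -s1; lra.
rewrite [ltRHS](_ : _ = ((11 + 25 * s - 26 * s ^+ 2 + 26 * s ^+ 3)
  + 2 * (b * (29 - 26 * s + 19 * s ^+ 2 - 4 * s ^+ 3))
  + b ^+ 2 * ((1 - s) * (27 - 18 * s + 18 * s ^+ 2))) / 8); last by field.
have h1 := mulr_ge0 b0 f1; have h2 := mulr_ge0 (sqr_ge0 b) f2.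
by rewrite divr_gt0// ltr_wpDr// ltr_wpDr// mulr_ge0.
Qed.

(** The same hypothesis for the coefficients of [gap5], sorted by powers of [s]. *)
Lemma quintic_edge_gt0 (R : realType) (a s : R) : 0 <= a -> a <= 5^-1 -> 0 <= s -> s <= 1 ->
  0 < (18 - 158 * a + 398 * a ^+ 2 - 288 * a ^+ 3)
      + s * (- 16 + 230 * a - 776 * a ^+ 2 + 672 * a ^+ 3)
      + s ^+ 2 * (10 - 178 * a + 600 * a ^+ 2 - 528 * a ^+ 3)
      + s ^+ 3 * (70 * a - 300 * a ^+ 2 + 288 * a ^+ 3).
Proof.
move=> a0 a1 s0 s1.
have [b [b0 b1 ->]] : exists b, [/\ 0 <= b, b <= 1 & a = (1 - b) / 5].
  by exists (1 - 5 * a); split; [lra | lra | field].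
(* Expand in powers of b; the negative b^3 coefficient is absorbed by that of b. *)
have f0 : 0 < 16 + 4336 * s - 5824 * s ^+ 2 + 4304 * s ^+ 3.
  by have := mulr_ge0 s0 (sqr_ge0 (4304 * s - 2912)); clear -s0; lra.
(* The value 6000 only has to be shared with [f3]: the two terms then add up to at least 6000 (b -
   b^3) >= 0. *)
have f1 : 6000 <= 6672 - 48 * s + 272 * s ^+ 2 + 3088 * s ^+ 3.
  have : 0 <= s ^+ 3 by rewrite exprn_ge0.
  by have := sqr_ge0 s; clear -s1; lra.
have f2 : 0 <= 9008 - 14912 * s + 11328 * s ^+ 2 - 5088 * s ^+ 3.
  have s10 : 0 <= 1 - s by rewrite subr_ge0.
  by have := mulr_ge0 s10 (sqr_ge0 (7 * s - 4)); have := sqr_ge0 (s - 1); clear -s1; lra.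
have f3 : - 6000 <= 2304 - 5376 * s + 4224 * s ^+ 2 - 2304 * s ^+ 3.
  have : s ^+ 3 <= 1 by rewrite exprn_ile1.
  by have := sqr_ge0 s; clear -s1; lra.
have b3 : b ^+ 3 <= b by rewrite -[leRHS]mulr1 exprS ler_wpM2l// exprn_ile1.
have b30 : 0 <= b ^+ 3 by rewrite exprn_ge0.
have g1 := ler_wpM2l b0 f1.
have g2 := mulr_ge0 (sqr_ge0 b) f2.
have g3 := ler_wpM2l b30 f3.
rewrite [ltRHS](_ : _ = ((16 + 4336 * s - 5824 * s ^+ 2 + 4304 * s ^+ 3)
  + b * (6672 - 48 * s + 272 * s ^+ 2 + 3088 * s ^+ 3)
  + b ^+ 2 * (9008 - 14912 * s + 11328 * s ^+ 2 - 5088 * s ^+ 3)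
  + b ^+ 3 * (2304 - 5376 * s + 4224 * s ^+ 2 - 2304 * s ^+ 3)) / 1000); last by field.
rewrite divr_gt0//.
move: f0 g1 g2 g3 {f1 f2 f3}.
move: (_ + 4304 * _) (b * (_ + 3088 * _)) (b ^+ 2 * _) (b ^+ 3 * (_ - _)) => F0 F1 F2 F3.
by clear -b3; lra.
Qed.

(* The last hypothesis is the case V = s (1 - s), divided by s; the two before it give V = 0. *)
Lemma quadratic_gap (R : realType) (A B c e f s V d : R) :
  0 <= A -> 0 <= B -> 0 < s <= 1 -> 0 <= V -> V <= s * (1 - s) ->
  s + (1 - s) * V / (2 + s) <= d ->
  0 < A - c -> 0 <= B - e - f ->
  0 < (2 + s) * (A - c - e + s * (B - f)) + (A + 2 * B * s) * (1 - s) ^+ 2 ->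
  c * s + e * (V + s ^+ 2) + f * s ^+ 2 < A * d + B * d ^+ 2.
Proof.
move=> A0 B0 /andP[s0 s1] V0 Vs dD Ac Be E0.
(* The tangent of [d ^+ 2] at [s] makes the right-hand side linear in [d], with slope at least 0 by
   [K], so the lower bound on [d] can be inserted. *)
have d2 : B * (2 * s * d - s ^+ 2) <= B * d ^+ 2.
  by rewrite ler_wpM2l// -subr_ge0; have := sqr_ge0 (d - s); lra.
have K : 0 <= A + 2 * B * s by rewrite addr_ge0// mulr_ge0 ?mulr_ge0// ltW.
have {}dD := ler_wpM2l K dD.
pose c1 := (A + 2 * B * s) * (1 - s) - e * (2 + s).
pose T := (2 + s) * (A - c + s * (B - e - f)).
have T0 : 0 < T.
  by apply: mulr_gt0; [lra | rewrite ltr_wpDr// mulr_ge0// ltW].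
(* Times [2 + s], the resulting difference is affine in [V] with slope [c1], whose sign tells which
   end of the range of [V] is worst. *)
suff G : 0 < s * T + V * c1.
  have s2 : 0 < 2 + s by lra.
  have : 0 < (s * T + V * c1) / (2 + s) by rewrite divr_gt0.
  have -> : (s * T + V * c1) / (2 + s) =
    (A + 2 * B * s) * (s + (1 - s) * V / (2 + s)) - B * s ^+ 2
    - (c * s + e * (V + s ^+ 2) + f * s ^+ 2).
    by rewrite /T /c1; field; rewrite gt_eqF.
  by lra.
have [c10|c10] := leP 0 c1.
  by have := mulr_ge0 V0 c10; have := mulr_gt0 s0 T0; lra.
have := ler_wnM2r (ltW c10) Vs.
suff : 0 < s * (T + (1 - s) * c1) by lra.
by rewrite mulr_gt0//; move: E0; congr (_ < _); rewrite /T /c1; ring.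
Qed.

(** * Moments of the entries and the relative defect of [sigma] *)

Lemma simplex_moments (R : realType) n (x : 'I_n -> R) (a : R) :
  in_simplex x -> 0 < a -> (forall i, x i <= a) ->
  (exists2 i, x i != 0 & x i != a) ->
  exists s v : R, [/\ \sum_i x i ^+ 2 = a * (1 - s),
    \sum_i x i ^+ 3 = a ^+ 2 * (1 - 2 * s + v),
    a ^+ 3 * (1 - 3 * s + 2 * v) <= \sum_i x i ^+ 4,
    0 < s < 1 & s ^+ 2 <= v <= s].
Proof.
move=> [x0 x1] a0 xa [j xj0 xja].
set p2 := \sum_i x i ^+ 2; set p3 := \sum_i x i ^+ 3; set p4 := \sum_i x i ^+ 4.
have an0 : a != 0 by rewrite gt_eqF.
have p2a : 0 < a - p2.
  have -> : a - p2 = \sum_i x i * (a - x i).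
    rewrite -[in LHS](mulr1 a) -x1 mulr_sumr -sumrB; apply: eq_bigr => i _; ring.
  rewrite lt0r sumr_ge0 => [|i _]; last by rewrite mulr_ge0// subr_ge0.
  rewrite andbT; apply/negP => /eqP/psumr_eq0P H.
  have /eqP := H (fun i _ => mulr_ge0 (x0 i) (etrans (subr_ge0 _ _) (xa i))) j isT.
  by rewrite mulf_eq0 (negbTE xj0) subr_eq0 eq_sym (negbTE xja).
have p20 : 0 < p2.
  rewrite lt0r sumr_ge0 => [|i _]; last by rewrite sqr_ge0.
  rewrite andbT; apply/negP => /eqP/psumr_eq0P H.
  have /eqP := H (fun i _ => sqr_ge0 (x i)) j isT.
  by rewrite sqrf_eq0 (negbTE xj0).
have p3p2 : p2 ^+ 2 <= p3.
  have : 0 <= \sum_i x i * (x i - p2) ^+ 2.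
    by apply: sumr_ge0 => i _; rewrite mulr_ge0// sqr_ge0.
  have -> : \sum_i x i * (x i - p2) ^+ 2
      = \sum_i (x i ^+ 3 - 2 * p2 * x i ^+ 2 + p2 ^+ 2 * x i).
    by apply: eq_bigr => i _; ring.
  by rewrite big_split sumrB/= -!mulr_sumr x1 -/p2 -/p3; lra.
have p3a : p3 <= a * p2.
  rewrite mulr_sumr; apply: ler_sum => i _.
  by rewrite exprS ler_wpM2r// sqr_ge0.
have p4a : 0 <= p4 - 2 * a * p3 + a ^+ 2 * p2.
  rewrite !mulr_sumr -sumrB -big_split/=; apply: sumr_ge0 => i _.
  have -> : x i ^+ 4 - 2 * a * x i ^+ 3 + a ^+ 2 * x i ^+ 2 = (x i * (a - x i)) ^+ 2 by ring.
  exact: sqr_ge0.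
(* E u is [p2 / a] and E u^2 is [p3 / a ^+ 2], so these are E(1 - u) and E(1 - u)^2. *)
exists (1 - p2 / a), (p3 / a ^+ 2 + 1 - 2 * (p2 / a)).
have a20 : 0 < a ^+ 2 by rewrite exprn_gt0.
split.
- by field.
- by field.
- by rewrite -subr_ge0; move: p4a; congr (_ <= _); field.
- have : p2 / a < 1 by rewrite ltr_pdivrMr//; lra.
  have : 0 < p2 / a by rewrite divr_gt0.
  by lra.
have : p3 / a ^+ 2 <= p2 / a.
  by rewrite ler_pdivrMr//; move: p3a; congr (_ <= _); field.
have : (p2 / a) ^+ 2 <= p3 / a ^+ 2.
  by rewrite ler_pdivlMr//; move: p3p2; congr (_ <= _); field.
by move=> h1 h2; apply/andP; split; lra.
Qed.

(** Here 1 / (1 + V/2) = 1 - V / (2 + V); enlarging the denominator to [2 + s] makes the bound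
    affine in [V]. *)
Lemma relative_defect_ge (R : realType) (a s V t : R) :
  0 < a -> 0 < s < 1 -> 0 <= V <= s -> t <= a * (1 - s) / (1 + V / 2) ->
  s + (1 - s) * V / (2 + s) <= 1 - t / a.
Proof.
move=> a0 /andP[s0 s1] /andP[V0 Vs] ht.
have : t / a <= 1 - s - (1 - s) * V / (2 + V).
  rewrite ler_pdivrMr//; apply: (le_trans ht); rewrite le_eqVlt; apply/orP; left.
  by apply/eqP; field; rewrite !gt_eqF//; lra.
have : (1 - s) * V / (2 + s) <= (1 - s) * V / (2 + V).
  rewrite ler_wpM2l ?mulr_ge0//; first lra.
  by rewrite lef_pV2 ?posrE; lra.
by lra.
Qed.

(** * The comparison for k = 3, 4, 5, divided by [a] *)

Lemma gap3 (R : realType) (a s V d : R) :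
  0 < a <= 3^-1 -> 0 < s < 1 -> 0 <= V <= s * (1 - s) ->
  s + (1 - s) * V / (2 + s) <= d ->
  s < (3 - 4 * a) * d + 2 * a * d ^+ 2.
Proof.
move=> /andP[a0 ak] /andP[s0 s1] /andP[V0 Vs] D.
have s01 : 0 < s <= 1 by rewrite s0 ltW.
have quad := quadratic_gap _ _ _ _ _ _ _ _ _ _ _ s01 V0 Vs D.
clear V0 Vs D.
have -> : s = 1 * s + 0 * (V + s ^+ 2) + 0 * s ^+ 2 by ring.
apply: quad; [lra.. | ].
apply: ltr_wpDr.
  by apply: mulr_ge0; [rewrite addr_ge0 ?mulr_ge0 ?(ltW a0) ?(ltW s0)//; lra | exact: sqr_ge0].
by apply: mulr_gt0; [lra | rewrite ltr_wpDr ?mulr_ge0 ?(ltW s0)//; lra].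
Qed.

Lemma gap4 (R : realType) (a s V d : R) :
  0 < a <= 4^-1 -> 0 < s < 1 -> 0 <= V <= s * (1 - s) ->
  s + (1 - s) * V / (2 + s) <= d ->
  (3 - 7 * a) * s + 2 * a * (V + s ^+ 2) <
    (6 - 22 * a + 18 * a ^+ 2) * d + (11 * a - 18 * a ^+ 2) * d ^+ 2.
Proof.
move=> /andP[a0 ak] /andP[s0 s1] /andP[V0 Vs] D.
have s01 : 0 < s <= 1 by rewrite s0 ltW.
have quad := quadratic_gap _ _ _ _ _ _ _ _ _ _ _ s01 V0 Vs D.
clear V0 Vs D.
have aB : 0 <= a * (11 - 18 * a) by rewrite mulr_ge0 ?(ltW a0)//; lra.
have aBe : 0 <= a * (1 - 2 * a) by rewrite mulr_ge0 ?(ltW a0)//; lra.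
(* A - c is 3 times this product, and B - e - f is 9 times the one in [aBe]. *)
have aAc : 0 < (1 - 2 * a) * (1 - 3 * a) by rewrite mulr_gt0//; lra.
rewrite -[ltLHS]addr0 -[X in _ + X < _](mul0r (s ^+ 2)).
apply: quad; [lra.. | ].
have /(_ a s ak) := @quartic_edge_gt0 R; rewrite !ltW// => /(_ isT).
by congr (_ < _); ring.
Qed.

Lemma gap5 (R : realType) (a s V d : R) :
  0 < a <= 5^-1 -> 0 < s < 1 -> 0 <= V <= s * (1 - s) ->
  s + (1 - s) * V / (2 + s) <= d ->
  (6 - 34 * a + 46 * a ^+ 2) * s + (8 * a - 20 * a ^+ 2) * (V + s ^+ 2) + 3 * a * s ^+ 2 <
    (10 - 70 * a + 150 * a ^+ 2 - 96 * a ^+ 3) * d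
    + (35 * a - 150 * a ^+ 2 + 144 * a ^+ 3) * d ^+ 2.
Proof.
move=> /andP[a0 ak] /andP[s0 s1] /andP[V0 Vs] D.
have s01 : 0 < s <= 1 by rewrite s0 ltW.
have quad := quadratic_gap _ _ _ _ _ _ _ _ _ _ _ s01 V0 Vs D.
clear V0 Vs D.
have aef : 0 <= a * (11 - 20 * a) by rewrite mulr_ge0 ?(ltW a0)//; lra.
have sq := sqr_ge0 (a - 5^-1).
have aBef : 0 <= a * (24 - 130 * a + 144 * a ^+ 2) by rewrite mulr_ge0 ?(ltW a0)//; lra.
(* A - c is 4 times this product. *)
have aAc : 0 < (1 - 2 * a) * (1 - 3 * a) * (1 - 4 * a) by rewrite !mulr_gt0//; lra.
apply: quad; [lra.. | ].
have := quintic_edge_gt0 _ a s (ltW a0) ak (ltW s0) (ltW s1).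
by congr (_ < _); ring.
Qed.

Theorem theorem4 (R : realType) (k n : nat) (x : 'I_n.+1 -> R) :
  (3 <= k <= 5)%N ->
  in_simplex x ->
  (forall i j : 'I_n.+1, (i <= j)%N -> x j <= x i) ->
  x ord0 <= k%:R^-1 ->
  ~ (forall i j : 'I_n.+1, x i != 0 -> x j != 0 -> x i = x j) ->
  dSk_dx1 k x < k%:R * sigma x ^+ k * binomR (sigma x)^-1 k.
Proof.
move=> k35 xS mono xk neq; have [x0 x1] := xS.
set a := x ord0 in xk *.
have xa i : x i <= a by exact: mono.
have a0 : 0 < a.
  (* If [a] were 0, all entries would vanish and the nonzero ones would be equal vacuously. *)
  rewrite lt0r x0 andbT; apply: contra_notN neq => /eqP aE i j /eqP[].
  by apply/le_anti; rewrite x0 -aE xa.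
have [i xi0 xia] : exists2 i, x i != 0 & x i != a.
  have [i /andP[]|H] := pickP (fun i => (x i != 0) && (x i != a)); first by exists i.
  have E l : x l != 0 -> x l = a.
    by move=> l0; have := H l; rewrite l0 => /negbFE/eqP.
  by case: neq => i j i0 j0; rewrite (E i i0) (E j j0).
have [s [v [p2 p3 p4 s01 vs]]] := simplex_moments _ _ _ _ xS a0 xa (ex_intro2 _ _ i xi0 xia).
have /andP[s0 s1] := s01; have /andP[v0 v1] := vs.
have V0 : 0 <= v - s ^+ 2 by lra.
have VV : 0 <= v - s ^+ 2 <= s * (1 - s) by apply/andP; split; lra.
have Vs' : v - s ^+ 2 <= s by have := sqr_ge0 s; lra.
set t := sigma x; have t0 : 0 < t by exact: sigma_gt0.
have D : s + (1 - s) * (v - s ^+ 2) / (2 + s) <= 1 - t / a.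
  apply: relative_defect_ge => //; first by rewrite V0.
  apply: sigma_le_moments => //; first by apply/andP; split; lra.
  by rewrite p3; ring.
have [d [dE d0]] : exists d, t = a * (1 - d) /\ 0 <= d.
  exists (1 - t / a); split; first by field; rewrite gt_eqF.
  apply: le_trans D; rewrite addr_ge0 ?(ltW s0)// divr_ge0 ?mulr_ge0//; lra.
have td : 1 - t / a = d by rewrite dE; field; rewrite gt_eqF.
rewrite td in D.
have q j : \sum_(i in [set i : 'I_n.+1 | i != ord0]) x i ^+ j = \sum_i x i ^+ j - a ^+ j.
  by rewrite [in RHS](bigD1 ord0)//= addrC addrK; apply: eq_bigl => l; rewrite inE.
have q1 : \sum_i x i ^+ 1 = 1 by rewrite -[RHS]x1; apply: eq_bigr.
have [] := esymA_newton _ _ [set i : 'I_n.+1 | i != ord0] x.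
rewrite /= !q q1 p2 p3 => _ e2 e3 e4.
have vE : v = v - s ^+ 2 + s ^+ 2 by rewrite subrK.
have tn0 : t != 0 by rewrite gt_eqF.
rewrite /dSk_dx1 /binomR.
case: k k35 xk => [|[|[|[|[|[|k]]]]]]//= _ xk; rewrite !big_ord_recr big_ord0/=.
- have -> : 3 * t ^+ 3 * (1 * (t^-1 - 0) * (t^-1 - 1) * (t^-1 - 2) / 6) =
      (1 - t) * (1 - 2 * t) / 2 by field.
  have := gap3 _ a s _ d _ s01 VV D; rewrite a0 xk => /(_ isT).
  by rewrite -(ltr_pM2l a0) dE; clear -e2; lra.
- have -> : 4 * t ^+ 4 * (1 * (t^-1 - 0) * (t^-1 - 1) * (t^-1 - 2) * (t^-1 - 3) / 24) =
      (1 - t) * (1 - 2 * t) * (1 - 3 * t) / 6 by field.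
  have := gap4 _ a s _ d _ s01 VV D; rewrite a0 xk -vE => /(_ isT).
  (* Up to a factor 6, the cubic term in d of h(a (1 - d)), absent from [gap4]. *)
  have : 0 <= a ^+ 3 * d ^+ 3 by rewrite mulr_ge0 ?exprn_ge0// ltW.
  by rewrite -(ltr_pM2l a0) dE; clear -e3; lra.
- have -> : 5 * t ^+ 5
      * (1 * (t^-1 - 0) * (t^-1 - 1) * (t^-1 - 2) * (t^-1 - 3) * (t^-1 - 4) / 120) =
      (1 - t) * (1 - 2 * t) * (1 - 3 * t) * (1 - 4 * t) / 24 by field.
  have := gap5 _ a s _ d _ s01 VV D; rewrite a0 xk -vE => /(_ isT).
  (* The terms of degree 3 and 4 in d, the latter up to a factor 24, are likewise dropped. *)
  have : 0 <= a ^+ 3 * (50 - 96 * a) * d ^+ 3.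
    rewrite mulr_ge0 ?exprn_ge0// mulr_ge0 ?exprn_ge0 ?(ltW a0)//.
    by clear -xk; lra.
  have : 0 <= a ^+ 4 * d ^+ 4 by rewrite mulr_ge0 ?exprn_ge0// ltW.
  (* The fourth power sum enters [e4] with coefficient -6, so its lower bound [p4] is the one
     needed. *)
  by rewrite -(ltr_pM2l a0) dE; clear -e4 p4; lra.
Qed.
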